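(* Let $K$ be an infinite field of characteristic different from $2$ and $3$, and let $A=Ke\oplus U\oplus V$ be a finitely generated Bernstein algebra over $K$ such that the operators $L_v:U\to U$ satisfy $L_v^2=0$ for all $v\in V$. Then $A$ is finite-dimensional and $N=U\oplus V$ is nilpotent.
   Context: Algebras are not assumed associative, unital or finite-dimensional. A Bernstein algebra over $K$ is a commutative $K$-algebra $A$ with a nonzero algebra homomorphism $\omega:A\to K$ satisfying $(x^2)^2=\omega(x)^2x^2$ for all $x$. Here $e$ is a nonzero idempotent of $A$ (necessarily $\omega(e)=1$) and $A=Ke\oplus U\oplus V$ is the Peirce decomposition: $U=\{u\in A:2eu=u\}$, $V=\{v\in A:ev=0\}$, $\ker\omega=U\oplus V$; one has $UV\subseteq U$, so $L_v(u)=vu$ defines $L_v:U\to U$ for $v\in V$ (the hypothesis $L_v^2=0$ says $(uv)v=0$ for all $u\in U$, $v\in V$). Finitely generated means generated as an algebra by a finite subset. An algebra $N$ is nilpotent if $N^n=0$ for some $n$, where $N^1=N$ and $N^n=\sum_{i+j=n}N^iN^j$. *)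

(* Defs.v *)
From HB Require Import structures.
From mathcomp Require Import all_boot all_order all_algebra.
From mathcomp Require Import sesquilinear.
From mathcomp Require Import boolp classical_sets functions cardinality.

Set Implicit Arguments.
Unset Strict Implicit.
Unset Printing Implicit Defensive.

Import GRing.Theory.
Local Open Scope classical_set_scope.
Local Open Scope ring_scope.

Section NonassociativeAlgebras.
Variables (K : fieldType) (A : lmodType K).

(* A (not necessarily associative or unital) K-algebra is a vector space
   together with a bilinear product. *)
Variable mul : {bilinear A -> A -> A}.

Definition subspace (P : set A) : Prop :=
  P 0 /\ forall (a : K) x y, P x -> P y -> P (a *: x + y).

Definition span (S : set A) : set A := smallest subspace S.

(* Subalgebras are not required to contain a unit. *)
Definition subalgebra (P : set A) : Prop :=
  subspace P /\ forall x y, P x -> P y -> P (mul x y).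

Definition finitely_generated : Prop :=
  exists S : set A, finite_set S /\ smallest subalgebra S = [set: A].

(* Same linear isomorphism condition as in Vector.axiom of mathcomp's vector. *)
Definition finite_dimensional : Prop :=
  exists (n : nat) (f : A -> 'rV[K]_n), linear f /\ bijective f.

(* Both the product spaces N^i N^j and their sum over i + j = n are linear
   spans, so the sum is the span of all products xy with x in N^i, y in N^j.
   The argument d only bounds the depth of the recursion; see npowE. *)
Fixpoint npow_rec (N : set A) (d n : nat) : set A :=
  if d is d'.+1 then
    if (n <= 1)%N then N else
    span [set z | exists i j : nat, [/\ (0 < i)%N, (0 < j)%N, (i + j)%N = n
      & exists x y, [/\ npow_rec N d' i x, npow_rec N d' j y & z = mul x y]]]
  else N.

Definition npow (N : set A) (n : nat) : set A := npow_rec N n n.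

Let summand_leq i j n : (0 < i)%N -> (0 < j)%N -> (i + j)%N = n.+1 ->
  (i <= n)%N /\ (j <= n)%N.
Proof.
case: i j => [|i] [|j] // _ _; rewrite addSn => -[<-].
by rewrite addnS ltnS leq_addr ltnS leq_addl.
Qed.

Lemma npow_rec_stable N d n : (n <= d)%N -> npow_rec N d n = npow N n.
Proof.
rewrite /npow; elim/ltn_ind: n d => -[|n] IHn [|d] //= led.
case: ifP => // _; congr span; apply/seteqP; split => z [i [j [i0 j0 ijn]]] xyz;
  exists i, j; split=> //; move: xyz;
  have [lei lej] := summand_leq i0 j0 ijn;
  by rewrite (IHn i lei d (leq_trans lei led)) (IHn j lej d (leq_trans lej led))
             (IHn i lei n lei) (IHn j lej n lej).
Qed.

Lemma npow1 N : npow N 1 = N.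
Proof. by []. Qed.

Lemma npowE N n : (1 < n)%N -> npow N n =
  span [set z | exists i j : nat, [/\ (0 < i)%N, (0 < j)%N, (i + j)%N = n
    & exists x y, [/\ npow N i x, npow N j y & z = mul x y]]].
Proof.
case: n => [|n] // n1; rewrite {1}/npow /= leqNgt n1 /=.
congr span; apply/seteqP; split => z [i [j [i0 j0 ijn]]] xyz;
  exists i, j; split=> //; move: xyz;
  have [lei lej] := summand_leq i0 j0 ijn;
  by rewrite !npow_rec_stable.
Qed.

Definition nilpotent_set (N : set A) : Prop :=
  exists n : nat, (0 < n)%N /\ npow N n = [set 0].

Definition bernstein (omega : {scalar A}) : Prop :=
  [/\ forall x y, mul x y = mul y x,
      forall x y, omega (mul x y) = omega x * omega y,
      exists x, omega x != 0
    & forall x, mul (mul x x) (mul x x) = omega x ^+ 2 *: mul x x].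

Definition peirceU (e : A) : set A := [set u | 2 *: mul e u = u].
Definition peirceV (e : A) : set A := [set v | mul e v = 0].
Definition peirceN (e : A) : set A :=
  [set u + v | u in peirceU e & v in peirceV e].

End NonassociativeAlgebras.

(* Main.v *)
(** The Bernstein identity, polarised at [e], makes [V] act on [U] with
    [u1 (u2 v) = - u2 (u1 v)], [u1 (u2 u3) + u2 (u3 u1) + u3 (u1 u2) = 0] and
    [u (v w) = 0]; by hypothesis the operators [L_v] anticommute.
    Let [u_i] and [v_j] be the Peirce components of a finite set of generators.
    Every operator [L_v] is a combination of the [L_{v_j}] and of operators
    [L_{u_i x}].  For fixed [u = u_i], the form [L_{u x} L_{u y} z] is
    alternating modulo [L_{u u} U], whence any product of eight operators
    [L_{u x}] vanishes and long products of operators [L_v] vanish on [U].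
    In addition, if [v] has large degree in the generators, then [L_v u_l] is a
    combination of products of at least two operators, of the same degree,
    applied to generators: otherwise [v] is a long nest
    [u_{p0} ((u_{p1} ((...) u_{q1})) u_{q0})], and [L_v u_l] is alternating in
    the indices [l, p0, q0, p1, q1, ...] modulo such combinations, while there
    are only finitely many generators.  Iterating, a product of operators of
    large degree becomes a combination of arbitrarily long products, so all
    monomials of large degree vanish. *)

From HB Require Import structures.
Require Import Defs.
From mathcomp Require Import all_boot all_order all_algebra.
From mathcomp Require Import sesquilinear.
From mathcomp Require Import boolp classical_sets functions cardinality.
From mathcomp Require Import ring zify.

Set Implicit Arguments.
Unset Strict Implicit.
Unset Printing Implicit Defensive.

Import GRing.Theory.
Local Open Scope classical_set_scope.
Local Open Scope ring_scope.

(** * Closure properties of subspaces and spans *)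

Section Subspaces.
Variables (K : fieldType) (A : lmodType K).
Implicit Types (P S : set A).

Lemma subspaceD P x y : subspace P -> P x -> P y -> P (x + y).
Proof. by move=> [_ PD] Px Py; rewrite -[x]scale1r; apply: PD. Qed.

Lemma subspaceZ P (a : K) x : subspace P -> P x -> P (a *: x).
Proof. by move=> [P0 PD] Px; rewrite -[_ *: _]addr0; apply: PD. Qed.

Lemma subspaceN P x : subspace P -> P x -> P (- x).
Proof. by move=> Psub Px; rewrite -scaleN1r; apply: subspaceZ. Qed.

Lemma subspaceB P x y : subspace P -> P x -> P y -> P (x - y).
Proof. by move=> Psub Px Py; apply: subspaceD => //; apply: subspaceN. Qed.

Lemma subspace_set0 : subspace [set (0 : A)].
Proof. by split=> // a x y -> ->; rewrite scaler0 addr0. Qed.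

Lemma subspace_preimage (B : lmodType K) (f : {linear A -> B}) (P : set B) :
  subspace P -> subspace (f @^-1` P).
Proof.
move=> [P0 PD]; split => [|a x y Px Py]; first by rewrite /preimage /= linear0.
by rewrite /preimage /= linearP; apply: PD.
Qed.

Lemma subspace_span S : subspace (Defs.span S).
Proof.
split=> [P [[P0 _] _] // | a x y Sx Sy P PS].
by apply: PS.1.2; [apply: Sx | apply: Sy].
Qed.

Lemma sub_span S : S `<=` Defs.span S.
Proof. exact: sub_smallest. Qed.

Lemma span_min P S : subspace P -> S `<=` P -> Defs.span S `<=` P.
Proof. by move=> Psub SP; apply: smallest_sub. Qed.

Lemma addvv_eq0 (x : A) : (2 : K) != 0 -> x + x = 0 -> x = 0.
Proof.
move=> K2 /eqP; rewrite -mulr2n -scaler_nat scaler_eq0 (negPf K2) /=.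
exact: eqP.
Qed.

End Subspaces.

(** * Anticommuting operators on [U] and a skew symmetric product into [V] *)

Section AnticommutingActions.
Variables (K : fieldType) (U V : lmodType K).
Variables (act : {bilinear V -> U -> U}) (prd : {bilinear U -> U -> V}).
Hypothesis K2 : (2 : K) != 0.
Hypothesis actA : forall v w x, act v (act w x) = - act w (act v x).
Hypothesis prdC : forall x y, prd x y = prd y x.
Hypothesis prd_skew : forall x y v, prd x (act v y) = - prd y (act v x).
Hypothesis prd_cyc : forall x y z,
  act (prd x y) z + act (prd y z) x + act (prd z x) y = 0.

Implicit Types (c : seq U) (s t : seq V).

Definition acts s (x : U) : U := foldr (fun v => act v) x s.

Lemma acts_cat s t x : acts (s ++ t) x = acts s (acts t x).
Proof. exact: foldr_cat. Qed.

Lemma acts_is_linear s : linear (acts s).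
Proof. by elim: s => //= v s IHs a x y; rewrite /= IHs linearPr. Qed.

HB.instance Definition _ s :=
  GRing.isLinear.Build K U U *:%R (acts s) (acts_is_linear s).

Lemma act_sq0 v x : act v (act v x) = 0.
Proof. by apply: addvv_eq0 K2 _; rewrite {1}actA addNr. Qed.

Lemma act_acts v s x : act v (acts s x) = (-1) ^+ size s *: acts s (act v x).
Proof.
elim: s => [|w s IHs] /=; first by rewrite scale1r.
by rewrite actA IHs linearZr_LR exprS mulN1r scaleNr.
Qed.

(** Each use of [prd_skew], followed by commutativity, moves the outermost operator of the left
    factor onto the right one at the cost of a sign. The operators thus pile up in reverse order,
    whence [catrev]. *)
Lemma prd_acts s t x y :
  prd (acts s x) (acts t y) = (-1) ^+ size s *: prd x (acts (catrev s t) y).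
Proof.
elim: s t => [|v s IHs] t /=; first by rewrite scale1r.
rewrite prdC prd_skew (_ : act v _ = acts (v :: t) y) //.
by rewrite IHs exprS mulN1r scaleNr.
Qed.

Definition nil_class (C : set V) (n : nat) := forall s x,
  {in s, forall v, C v} -> (n <= size s)%N -> acts s x = 0.

(** Anticommutation sorts a word, up to sign, into letters of [C1] followed by letters of [C2], and
    one of the two blocks is long enough to vanish. *)
Lemma nil_class_setU C1 C2 n1 n2 :
  nil_class C1 n1 -> nil_class C2 n2 -> nil_class (C1 `|` C2) (n1 + n2).
Proof.
move=> nil1 nil2 s x sC les.
suff [c [s1 [s2 [s1C s2C sz ->]]]] : exists c : K, exists s1 s2,
    [/\ {in s1, forall v, C1 v}, {in s2, forall v, C2 v},
      size s = (size s1 + size s2)%N & acts s x = c *: acts (s1 ++ s2) x].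
  rewrite acts_cat; have [le1|lt1] := leqP n1 (size s1).
    by rewrite nil1 // scaler0.
  by rewrite (nil2 s2) // ?linear0 ?scaler0 //; lia.
elim: s sC {les} => [_|v s IHs sC].
  by exists 1, [::], [::]; rewrite scale1r.
have [|c [s1 [s2 [s1C s2C sz eqs]]]] := IHs.
  by move=> w ws; apply: sC; rewrite inE ws orbT.
have [Cv|Cv] := sC v (mem_head v s).
  exists c, (v :: s1), s2; split=> //=; [|by rewrite sz|by rewrite eqs linearZr_LR].
  by move=> w; rewrite inE => /predU1P[->|/s1C].
exists (c * (-1) ^+ size s1), s1, (v :: s2); split=> //=.
- by move=> w; rewrite inE => /predU1P[->|/s2C].
- by rewrite sz addnS.
- by rewrite eqs !acts_cat linearZr_LR /= act_acts scalerA.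
Qed.

Lemma nil_class_bigcup (I : eqType) (r : seq I) (C : I -> set V) n :
    (forall i, nil_class (C i) n) ->
  nil_class [set v | exists2 i, i \in r & C i v] (n * size r).+1.
Proof.
move=> nilC; elim: r => [|i r IHr].
  by case=> [|v s] x sC //; have [] := sC v (mem_head v s).
move=> s x sC les; apply: (nil_class_setU (nilC i) IHr); last by move: les => /=; lia.
move=> v vs; have [j] := sC v vs; rewrite inE => /predU1P[->|jr] Cv; first by left.
by right; exists j.
Qed.

Lemma nil_class1 v : nil_class [set v] 2.
Proof.
case=> [|w1 [|w2 s]] // x sC _; have -> : w1 = v by apply/sC/mem_head.
by rewrite /= (_ : w2 = v) ?act_sq0 //; apply: sC; rewrite !inE eqxx orbT.
Qed.

(** * Nilpotency of the operators [act (prd u x)] for a fixed [u] *)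

Section PrincipalImage.
Variable u : U.

(** This image is stable under all operators, by anticommutation, and is killed by [act (prd u u)],
    whose square is zero. *)
Let I : set U := range (act (prd u u)).
Let f x y z := act (prd u x) (act (prd u y) z).

Let I_sub : subspace I.
Proof.
split=> [|a _ _ [x _ <-] [y _ <-]]; first by exists 0; rewrite ?linear0r.
by exists (a *: x + y); rewrite ?linearPr.
Qed.

Let I_act v x : I x -> I (act v x).
Proof. by move=> [y _ <-]; rewrite actA -linearNr; exists (- act v y). Qed.

Let f_swap12 x y z : f y x z = - f x y z.
Proof. exact: actA. Qed.

(** The cyclic identity for [u], [y], [z] turns the sum into [- act (prd u x) (act (prd y z) u)].
    Once [act (prd y z)] is moved outside, [act (prd u x) u] remains, and the cyclic identity for
    [u], [u], [x] puts it in [I]. *)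
Let f_swap23 x y z : I (f x y z + f x z y).
Proof.
have half : act (prd u x) u = - (2^-1 *: act (prd u u) x).
  apply/eqP; rewrite -subr_eq0 opprK; apply/eqP/(addvv_eq0 K2).
  rewrite addrACA -scalerDl -[2^-1 + _]mulr2n -[2^-1 *+ 2]mulr_natl divff //.
  rewrite scale1r addrC.
  by rewrite addrA -[X in _ + act X u]prdC prd_cyc.
have -> : f x y z + f x z y = - act (prd u x) (act (prd y z) u).
  apply/eqP; rewrite -addr_eq0 -!linearDr [prd u z]prdC addrAC.
  by rewrite prd_cyc linear0r.
rewrite actA opprK half linearNr linearZr_LR.
by apply: subspaceN I_sub _; apply: subspaceZ I_sub _; apply: I_act; exists x.
Qed.

Let f_act v x y z : f x y (act v z) = act v (f x y z).
Proof. by rewrite /f [act (prd u y) _]actA linearNr actA opprK. Qed.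

(* Modulo [I] the form [f] is alternating, so [f_act] holds in its other
   arguments too; comparing the two ways to take out [v] and [w] then
   gives [v w f = w v f], while [v] and [w] anticommute. *)
Let f_act1 v x y z : I (f (act v x) y z - act v (f x y z)).
Proof.
have /(subspaceD I_sub) := f_swap23 (act v x) y z.
move=> /(_ _ (f_swap23 z (act v x) y)).
rewrite f_act [f z (act v x) y]f_swap12 addrA addrK => h1.
have := I_act v (f_swap23 z y x); rewrite linearDr => /(subspaceB I_sub h1).
rewrite opprD addrA addrK [f z x y]f_swap12 linearNr opprK => h2.
have := I_act v (f_swap23 x z y); rewrite linearDr => /(subspaceB I_sub h2).
by rewrite opprD addrA addrK.
Qed.

Let f_act2 v x y z : I (f x (act v y) z - act v (f x y z)).
Proof.
have := subspaceN I_sub (f_act1 v y x z).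
by rewrite opprB addrC [f x y z]f_swap12 linearNr opprK [f x _ z]f_swap12.
Qed.

Let act_act_f v w x y z : I (act v (act w (f x y z))).
Proof.
have := subspaceD I_sub (f_act1 v x (act w y) z) (I_act v (f_act2 w x y z)).
rewrite linearBr addrA subrK => h1.
have := subspaceD I_sub (f_act2 w (act v x) y z) (I_act w (f_act1 v x y z)).
rewrite linearBr addrA subrK => /(subspaceB I_sub h1).
rewrite opprB addrCA addrAC subrr add0r [act w _]actA -opprD => /(subspaceN I_sub).
rewrite opprK -mulr2n -scaler_nat => /(subspaceZ 2^-1 I_sub).
by rewrite scalerA mulVf // scale1r.
Qed.

Let I_four v w x y z : I (acts [:: v; w; prd u x; prd u y] z).
Proof. exact: act_act_f. Qed.

(** Four operators map into [I]. The inner block of four therefore produces a factor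
    [act (prd u u)]; moved past the outer block, it meets a second such factor, and its square is
    zero. *)
Lemma nil_class_prd : nil_class (range (prd u)) 8.
Proof.
case=> [|v1 [|v2 [|v3 [|v4 [|v5 [|v6 [|v7 [|v8 s]]]]]]]] // x sC _.
have C3 : range (prd u) v3 by apply: sC; rewrite !inE eqxx !orbT.
have C4 : range (prd u) v4 by apply: sC; rewrite !inE eqxx !orbT.
have C7 : range (prd u) v7 by apply: sC; rewrite !inE eqxx !orbT.
have C8 : range (prd u) v8 by apply: sC; rewrite !inE eqxx !orbT.
move: C3 C4 C7 C8 => [x3 _ <-] [x4 _ <-] [x7 _ <-] [x8 _ <-].
rewrite -[_ :: _]/([:: v1; v2; prd u x3; prd u x4] ++
  [:: v5; v6; prd u x7; prd u x8] ++ s) !acts_cat.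
have [t _ <-] := I_four v5 v6 x7 x8 (acts s x).
have := act_acts (prd u u) [:: v1; v2; prd u x3; prd u x4] t.
have [t' _ <-] := I_four v1 v2 x3 x4 t.
rewrite act_sq0 => /esym/eqP; rewrite scaler_eq0 signr_eq0 => /eqP ->.
by [].
Qed.
End PrincipalImage.

(** * Normal forms of monomials and their vanishing in large degree *)

Section NormalForms.
Variables (us : seq U) (vs : seq V).

(* Since the operators [act v] are skew for [prd] ([prd_acts]), operators can
   be moved off the left factor of a product, so these normal forms suffice. *)
Inductive vmon : nat -> V -> Prop :=
| VmonGen v : v \in vs -> vmon 1 v
| VmonPrd p q d s : p \in us -> q \in us -> vword d s ->
    vmon d.+2 (prd p (acts s q))
with vword : nat -> seq V -> Prop :=
| VwordNil : vword 0 [::]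
| VwordCons d1 d2 v s : vmon d1 v -> vword d2 s -> vword (d1 + d2) (v :: s).

Lemma vword1 d v : vmon d v -> vword d [:: v].
Proof. by move=> dv; rewrite -[d]addn0; apply: VwordCons dv VwordNil. Qed.

Lemma vword_cons d v s : vword d (v :: s) ->
  exists d1 d2, [/\ d = (d1 + d2)%N, vmon d1 v & vword d2 s].
Proof.
by move=> dvs; inversion dvs; exists d1, d2.
Qed.

Lemma vword_cat d1 d2 s t : vword d1 s -> vword d2 t -> vword (d1 + d2) (s ++ t).
Proof.
elim: s d1 => [|v s IHs] d1 ds dt.
  by inversion ds.
have [d11 [d12 [-> dv ds']]] := vword_cons ds.
by rewrite -addnA; apply: VwordCons dv _; apply: IHs.
Qed.

Lemma vword_catrev d1 d2 s t :
  vword d1 s -> vword d2 t -> vword (d1 + d2) (catrev s t).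
Proof.
elim: s d1 d2 t => [|v s IHs] d1 d2 t ds dt.
  exact: vword_cat ds dt.
have [d11 [d12 [-> dv ds']]] := vword_cons ds.
by rewrite addnAC addnC; apply: IHs ds' _; apply: VwordCons.
Qed.

Lemma vmon_class d v : vmon d v ->
  v \in vs \/ exists2 p, p \in us & range (prd p) v.
Proof.
case=> [w|p q n s pus qus _]; first by left.
by right; exists p => //; exists (acts s q).
Qed.

(** One class of exponent 2 for each [v] in [vs] and one of exponent 8 for each [p] in [us],
    combined by [nil_class_bigcup] and [nil_class_setU]. *)
Definition word_bound := ((2 * size vs).+1 + (8 * size us).+1)%N.

Lemma acts_vword_eq0 d s x : vword d s -> (word_bound <= size s)%N -> acts s x = 0.
Proof.
move=> ds les.
have nilvs := @nil_class_bigcup _ vs (fun v => [set v]) 2 nil_class1.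
have nilus := @nil_class_bigcup _ us (fun p => range (prd p)) 8 nil_class_prd.
apply: (nil_class_setU nilvs nilus) les.
elim: s d ds => // v s IHs d /vword_cons [d1 [d2 [_ /vmon_class dv /IHs sC]]] w.
rewrite inE => /predU1P [->|/sC //].
by case: dv => [vvs|vus]; [left; exists v | right].
Qed.

(* [d] bounds the degree of the word only: the generator [q] is not counted. *)
Definition Long (d : nat) : set U := Defs.span
  [set x | exists s q n, [/\ vword n s, q \in us, (1 < size s)%N, (d <= n)%N &
    x = acts s q]].

Lemma Long_sub d : subspace (Long d). Proof. exact: subspace_span. Qed.

Lemma Long_acts d n s q : vword n s -> q \in us -> (1 < size s)%N -> (d <= n)%N ->
  Long d (acts s q).
Proof. by move=> ns qus s1 dn; apply: sub_span; exists s, q, n. Qed.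

(** For [z = act v (acts s q)], skewness shifts [v] onto [p], and the cyclic identity for
    [acts s q], [act v p], [l] leaves two terms. One applies a new operator to [acts s q], where [s]
    is nonempty; the other applies a new operator to [act v p]. Both have at least two operators. *)
Lemma Long_act_prd d p l z : p \in us -> l \in us ->
  Long d z -> Long d.+2 (act (prd p z) l).
Proof.
move=> pus lus; pose g x := act (prd p x) l.
have g_lin : linear g by move=> a x y; rewrite /g linearPr linearPl.
pose gL : {linear U -> U} := HB.pack g (GRing.isLinear.Build K U U *:%R g g_lin).
apply: (span_min (subspace_preimage gL (Long_sub d.+2))).
move=> _ [[|v s] [q [n [dvs qus //= s_gt0 dn ->]]]].
have [d1 [d2 [en dv ds]]] := vword_cons dvs.
rewrite /preimage /= /g prd_skew linearNl.
have := prd_cyc (acts s q) (act v p) l.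
rewrite -addrA => /eqP; rewrite addr_eq0 => /eqP ->; rewrite opprK [prd _ l]prdC.
apply: subspaceD (Long_sub _) _ _.
- apply: (@Long_acts _ (d1.+2 + d2) (prd l (acts [:: v] p) :: s)) => //; last by lia.
  by apply: VwordCons ds; apply: VmonPrd (vword1 dv).
- apply: (@Long_acts _ (d2.+2 + d1) [:: prd l (acts s q); v]) => //; last by lia.
  by apply: VwordCons (vword1 dv); apply: VmonPrd.
Qed.

(** A nest of products around [w], with [c] listing p0, q0, p1, q1, ... from the outside in. Only
    even lengths are meant: a last unpaired letter is dropped. *)
Fixpoint chain (w : V) (c : seq U) : V :=
  if c is p :: q :: c' then prd p (act (chain w c') q) else w.

(** Putting the argument [l] in front of the letters of the nest makes all of them positions of a
    single list, in which the form is alternating modulo [Long]. The value 0 is a default. *)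
Definition chain_act (w : V) (c : seq U) : U :=
  if c is l :: c' then act (chain w c') l else 0.

Lemma vmon_chain d w c : vmon d w -> {subset c <= us} -> ~~ odd (size c) ->
  vmon (d + size c) (chain w c).
Proof.
move=> dw; have [n] := ubnP (size c); elim: n c => // n IHn [|p [|q c]] //=.
  by rewrite addn0.
move=> len cus; rewrite negbK => odc; rewrite !addnS.
apply: (@VmonPrd p q _ [:: chain w c]); [by apply: cus; rewrite !inE eqxx ?orbT..|].
apply: vword1; apply: IHn => [|x xc|//]; first by lia.
by apply: cus; rewrite !inE xc !orbT.
Qed.

(** The tail is written [c1 ++ i :: c2] to be nonempty, so that the default value of [chain_act] is
    not met. *)
Lemma chain_act_cons2 w l p c1 i c2 :
  chain_act w (l :: p :: (c1 ++ i :: c2)) =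
  act (prd p (chain_act w (c1 ++ i :: c2))) l.
Proof. by case: c1. Qed.

(** There are three cases. For the first two letters, the cyclic identity leaves a product of two
    operators; for the second and third, skewness of [prd] gives exact cancellation; deeper swaps
    reduce to these through [Long_act_prd], which removes two letters at a time. *)
Lemma chain_act_swap d w c1 i j c2 : vmon d w ->
    {subset c1 ++ i :: j :: c2 <= us} -> odd (size c1 + size c2) ->
  Long (d + (size c1 + size c2).+1)
    (chain_act w (c1 ++ i :: j :: c2) + chain_act w (c1 ++ j :: i :: c2)).
Proof.
move=> dw; have [n] := ubnP (size c1); elim: n c1 => // n IHn [|l [|p c1]] len cus odc.
(* By parity [c2] is nonempty, so the nest has an innermost argument [q] here. *)
- move: {len IHn} c2 cus odc => [|q c2] // cus odc; rewrite /= [prd i _]prdC.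
  have := prd_cyc i j (act (chain w c2) q).
  rewrite -addrA addrC => /eqP; rewrite addr_eq0 => /eqP ->.
  apply: subspaceN (Long_sub _) _.
  have c2us : {subset c2 <= us} by move=> x xc; apply: cus; rewrite !inE xc !orbT.
  rewrite add0n /= in odc.
  have wdc := vmon_chain dw c2us odc.
  apply: (@Long_acts _ (2 + (d + size c2)) [:: prd i (acts [::] j); chain w c2]) => //.
  + apply: VwordCons (vword1 wdc).
    by apply: VmonPrd VwordNil; apply: cus; rewrite !inE eqxx ?orbT.
  + by apply: cus; rewrite !inE eqxx !orbT.
  + by rewrite /=; lia.
- by rewrite /= prd_skew linearNl addNr; have [] := Long_sub (d + (1 + size c2).+1).
- have cus' : {subset c1 ++ i :: j :: c2 <= us}.
    by move=> x xc; apply: cus; rewrite !cat_cons !inE xc !orbT.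
  rewrite !cat_cons !chain_act_cons2.
  rewrite -linearDl -linearDr.
  have -> : (d + (size [:: l, p & c1] + size c2).+1 =
             (d + (size c1 + size c2).+1).+2)%N by rewrite /=; lia.
  apply: Long_act_prd; try by apply: cus; rewrite !inE eqxx ?orbT.
  apply: IHn => //; first by move: len => /=; lia.
  by move: odc; rewrite !addSn /= negbK.
Qed.

(** Adjacent swaps, each a sign change modulo [Long], bring two equal letters together; then
    swapping them shows that twice the value is in [Long]. The prefix [c1] collects the letters
    already passed. *)
Lemma chain_act_nonuniq d w c1 c : vmon d w ->
    {subset c1 ++ c <= us} -> odd (size (c1 ++ c)) -> ~~ uniq c ->
  Long (d + (size (c1 ++ c)).-1) (chain_act w (c1 ++ c)).
Proof.
move=> dw; elim: c c1 => // i c IHc c1 cus odc; rewrite /= negb_and negbK.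
have [ic _|_ /= nuc] := boolP (i \in c); last first.
  by rewrite -cat_rcons; apply: IHc => //; rewrite cat_rcons.
move: cus odc {IHc}; case/splitPr: ic => c2 c3 cus odc.
elim: c2 c1 cus odc => [|j c2 IHc2] c1 cus odc.
  have := @chain_act_swap d w c1 i i c3 dw cus.
  move: odc; rewrite !size_cat /= !addnS /= negbK => odc /(_ odc).
  rewrite -mulr2n -scaler_nat => /(subspaceZ 2^-1 (Long_sub _)).
  by rewrite scalerA mulVf // scale1r.
(* Swapping [i] with [j] sends [j] into the prefix and brings [i] one place closer to its copy. *)
have perm_ij : perm_eq (rcons c1 j ++ i :: c2 ++ i :: c3)
                       (c1 ++ i :: j :: c2 ++ i :: c3).
  by rewrite cat_rcons perm_cat2l; apply/permP => a /=; rewrite addnCA.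
have size_ij := perm_size perm_ij.
have h1 : Long (d + (size (c1 ++ i :: j :: c2 ++ i :: c3)).-1)
               (chain_act w (c1 ++ j :: i :: c2 ++ i :: c3)).
  rewrite -size_ij -(cat_rcons j c1); apply: IHc2; last by rewrite size_ij.
  by move=> x; rewrite (perm_mem perm_ij); apply: cus.
have := @chain_act_swap d w c1 i j (c2 ++ i :: c3) dw cus.
have sz : (size c1 + size (c2 ++ i :: c3)).+1 =
          (size (c1 ++ i :: j :: c2 ++ i :: c3)).-1.
  by rewrite (size_cat c1) /= !addnS.
move: odc; rewrite (size_cat c1) /= !addnS /= negbK => odc /(_ odc).
by rewrite -addnS sz => /(subspaceB (Long_sub _)) /(_ h1); rewrite addrK.
Qed.

(** Peels [H] layers, each of degree 2. A layer with a single operator continues the nest, and one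
    with at least two operators gives the first alternative; a generator or an empty layer has
    degree at most 2, which the degree hypothesis excludes. *)
Lemma vmon_unchain H d w : vmon d w -> (2 * H < d)%N ->
  (forall l, l \in us -> Long d (act w l)) \/
  exists w' c, [/\ vmon (d - 2 * H) w', size c = (2 * H)%N, {subset c <= us} &
    w = chain w' c].
Proof.
elim: H d w => [|H IHH] d w dw ltd.
  by right; exists w, [::]; rewrite subn0.
case: dw ltd => [v _|p q n [|v [|v' s]] pus qus dw] ltd; first by lia.
- by inversion dw; lia.
- have [d1 [d2 [en dv]]] := vword_cons dw; inversion 1; subst.
  have lt1 : (2 * H < d1)%N by lia.
  have [dv1|] := IHH _ _ dv lt1.
    by left=> l lus; rewrite addn0; apply: Long_act_prd => //; apply: dv1.
  case=> [w' [c [dw' sc cus ->]]]; right; exists w', [:: p, q & c]; split=> //.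
  + by move: dw'; congr vmon; lia.
  + by rewrite /= sc; lia.
  + by move=> x; rewrite !inE => /or3P[/eqP->|/eqP->|/cus].
- left=> l lus; apply: Long_act_prd => //.
  exact: Long_acts dw _ _ _.
Qed.

(** With [size us] layers peeled off, the list [l :: c] has [2 * size us + 1] letters from [us], so
    one is repeated. *)
Lemma Long_act_vmon d w l : vmon d w -> (2 * size us < d)%N -> l \in us ->
  Long d (act w l).
Proof.
move=> dw ltd lus; have [|[w' [c [dw' sc cus ew]]]] := vmon_unchain dw ltd.
  exact.
have -> : act w l = chain_act w' ([::] ++ l :: c) by rewrite ew.
have -> : d = (d - 2 * size us + (size ([::] ++ l :: c)).-1)%N by rewrite /= sc; lia.
have lcus : {subset l :: c <= us} by move=> x; rewrite inE => /predU1P[->|/cus].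
apply: chain_act_nonuniq => //; first by rewrite /= sc; lia.
by apply: contraL ltd => /uniq_leq_size /(_ lcus) /=; rewrite sc; lia.
Qed.

(** Some letter has degree above [D] by averaging, and anticommutation moves it to the innermost
    place; [c] is the resulting sign. *)
Lemma vword_big d s D : vword d s -> (size s * D < d)%N ->
  exists t v n1 n2 (c : K), [/\ vword n1 t, vmon n2 v, (D < n2)%N,
    (n1 + n2 = d)%N /\ size s = (size t).+1 & 
    forall x, acts s x = c *: acts t (act v x)].
Proof.
elim: s d => [|v s IHs] d ds; first by inversion ds.
have [d1 [d2 [-> dv ds2]]] := vword_cons ds => /= ltd.
have [ltD|leD] := ltnP D d1.
  exists s, v, d2, d1, ((-1) ^+ size s); split=> //; first by rewrite addnC.
  by move=> x; rewrite act_acts.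
have [|t [w [n1 [n2 [c [dt dw ltn2 [en ->] st]]]]]] := IHs _ ds2; first by lia.
exists (v :: t), w, (d1 + n1)%N, n2, c; split=> //; first exact: VwordCons.
  by split=> //; lia.
by move=> x; rewrite st linearZr_LR.
Qed.

Definition degree_bound := (word_bound * (2 * size us).+1)%N.

(** A word shorter than [word_bound] has a letter of degree above [2 * size us]. [Long_act_vmon]
    replaces it by at least two operators without lowering the degree, so the words grow until they
    reach [word_bound]. *)
Lemma acts_gen_eq0 d s q : vword d s -> q \in us -> (degree_bound <= d)%N ->
  acts s q = 0.
Proof.
have [n] := ubnP (word_bound - size s).
elim: n s d q => // n IHn s d q len ds qus led.
have [les|lts] := leqP word_bound (size s); first exact: acts_vword_eq0 ds les.
have [|t [v [n1 [n2 [c [dt dv ltn2 [en sz] ->]]]]]] := @vword_big d s (2 * size us) ds.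
  by move: led; rewrite /degree_bound mulnS; nia.
suff t0 : Long n2 `<=` acts t @^-1` [set 0].
  by rewrite (t0 _ (Long_act_vmon dv ltn2 qus)) scaler0.
apply: span_min; first exact: (subspace_preimage _ (@subspace_set0 _ _)).
move=> _ [s' [q' [n' [ds' q'us s'1 len' ->]]]].
rewrite /preimage /= -acts_cat; apply: IHn (vword_cat dt ds') q'us _; last by lia.
by rewrite size_cat; lia.
Qed.

Lemma vmon_eq0 d v : vmon d v -> (degree_bound.+2 <= d)%N -> v = 0.
Proof.
case=> [w _|p q n s pus qus ds led]; first by [].
by rewrite (acts_gen_eq0 ds) ?linear0r.
Qed.

Variable vv : {bilinear V -> V -> U}.
Hypothesis prd_vv : forall x v w, prd x (vv v w) = 0.

(** Here the degree counts the generator [q]. Products of two elements of [V] fall in [U] and need a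
    second normal form, which [prd] annihilates. *)
Inductive umon : nat -> U -> Prop :=
| UmonGen d s q : vword d s -> q \in us -> umon d.+1 (acts s q)
| UmonVV d d1 d2 s v w : vword d s -> vmon d1 v -> vmon d2 w ->
    umon (d + (d1 + d2)) (acts s (vv v w)).

Lemma umon_act d1 d2 v x : vmon d1 v -> umon d2 x -> umon (d1 + d2) (act v x).
Proof.
move=> dv [d s q ds qus|d d' d'' s w w' ds dw dw'].
  by rewrite addnS; apply: (UmonGen (VwordCons dv ds)).
by rewrite addnA; apply: (UmonVV (VwordCons dv ds)).
Qed.

Lemma prd_umon d1 d2 x y : umon d1 x -> umon d2 y ->
  prd x y = 0 \/ exists (c : K) v, vmon (d1 + d2) v /\ prd x y = c *: v.
Proof.
have prd_vv_acts s v w z : prd z (acts s (vv v w)) = 0.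
  by rewrite prdC (prd_acts s [::] (vv v w) z) prdC prd_vv scaler0.
case=> [d s q ds qus|d d' d'' s w w' ds dw dw']
  [e t p dt pus|e e' e'' t u u' dt du du'];
  try by left; rewrite ?prd_vv_acts // prdC prd_vv_acts.
right; exists ((-1) ^+ size s), (prd q (acts (catrev s t) p)).
rewrite prd_acts addSn addnS; split => //.
by apply: VmonPrd => //; apply: vword_catrev.
Qed.

(** In [acts s (vv v w)] with [s] short there are at most [word_bound + 2] factors, so in this
    degree one of them reaches degree [degree_bound.+2] and is zero. *)
Definition umon_bound := ((word_bound + 2) * degree_bound.+2)%N.

Lemma umon_eq0 d x : umon d x -> (umon_bound <= d)%N -> x = 0.
Proof.
rewrite /umon_bound => dx; case: dx => [{}d s q ds qus|{}d d1 d2 s v w ds dv dw] led.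
  by apply: acts_gen_eq0 ds qus _; nia.
have [les|lts] := leqP word_bound (size s); first exact: acts_vword_eq0 ds les.
have [led1|ltd1] := leqP degree_bound.+2 d1.
  by rewrite (vmon_eq0 dv led1) linear0l linear0.
have [led2|ltd2] := leqP degree_bound.+2 d2.
  by rewrite (vmon_eq0 dw led2) linear0r linear0.
have [|t [u [n1 [n2 [c [dt du ltn2 _ ->]]]]]] := @vword_big d s degree_bound.+2 ds.
  by nia.
by rewrite (vmon_eq0 du (ltnW ltn2)) linear0l linear0 scaler0.
Qed.

End NormalForms.
End AnticommutingActions.

(** * Finite dimension from a finite spanning family *)

Section FiniteDimension.
Variables (K : fieldType) (A : lmodType K).

Lemma finite_dimensional_surj m (g : {linear 'rV[K]_m -> A}) :
  (forall x, exists r, g r = x) -> finite_dimensional A.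
Proof.
elim: m g => [|m IHm] g g_surj.
  have [h hK] := choice g_surj; exists 0, h; split.
    by move=> a x y; rewrite [LHS]thinmx0 [RHS]thinmx0.
  by exists g => // r; rewrite [LHS]thinmx0 [RHS]thinmx0.
have [g_inj|] := pselect (forall r, g r = 0 -> r = 0).
  have [h hK] := choice g_surj.
  have ginj : injective g.
    by move=> x y gxy; apply/subr0_eq/g_inj; rewrite linearB gxy subrr.
  exists m.+1, h; split; last by exists g => // r; apply: ginj; rewrite hK.
  by move=> a x y; apply: ginj; rewrite linearP !hK.
move=> /existsNP [r /not_implyP [gr0 /eqP/rV0Pn [j rj]]].
(* [ins] inserts a zero at coordinate [j]. Since the kernel vector [r] is nonzero there, subtracting
   a multiple of it clears that coordinate without changing the image, so [g \o ins] is still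
   onto. *)
pose ins (y : 'rV[K]_m) : 'rV[K]_m.+1 := \row_i oapp (y 0) 0 (unlift j i).
have g'_lin : linear (g \o ins).
  move=> a x y; rewrite /= -linearP; congr (g _); apply/rowP => i; rewrite !mxE.
  by case: unliftP => [k _|_] /=; rewrite ?mxE // mulr0 addr0.
apply: (IHm (HB.pack (g \o ins) (GRing.isLinear.Build K _ _ *:%R (g \o ins) g'_lin))).
move=> x; have [z <-] := g_surj x.
exists (\row_i (z - (z 0 j / r 0 j) *: r) 0 (lift j i)).
transitivity (g (z - (z 0 j / r 0 j) *: r)); last first.
  by rewrite linearB linearZ /= gr0 scaler0 subr0.
congr (g _); apply/rowP => i; rewrite [LHS]mxE.
case: unliftP => [k ->|->] /=; first by rewrite [LHS]mxE.
by rewrite !mxE divfK ?subrr.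
Qed.

Lemma finite_dimensional_span (s : seq A) :
  Defs.span [set` s] = [set: A] -> finite_dimensional A.
Proof.
move=> spanT; pose g (r : 'rV[K]_(size s)) := \sum_i r 0 i *: s`_i.
have g_lin : linear g.
  move=> a x y; rewrite /g scaler_sumr -big_split; apply: eq_bigr => i _ /=.
  by rewrite !mxE scalerDl scalerA.
apply: (@finite_dimensional_surj _ (HB.pack g (GRing.isLinear.Build K _ _ *:%R g g_lin))).
suff: Defs.span [set` s] `<=` range g.
  by rewrite spanT => gT x; have [r _ <-] := gT x I; exists r.
apply: span_min => [|x /= /(nthP 0) [i lti <-]].
  split; first by exists 0 => //; rewrite /g big1 // => i _; rewrite mxE scale0r.
  by move=> a _ _ [x _ <-] [y _ <-]; exists (a *: x + y); rewrite ?g_lin.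
exists (delta_mx 0 (Ordinal lti)) => //; rewrite /g (bigD1 (Ordinal lti)) //= mxE !eqxx.
rewrite scale1r big1 ?addr0 // => j ne; rewrite mxE eqxx /=.
by rewrite (negPf ne) scale0r.
Qed.

End FiniteDimension.

(** * Extraction of coefficients and polarisation of identities *)

Section Polarization.
Variables (K : fieldType) (A : lmodType K).
Hypothesis K2 : (2 : K) != 0.
Variable N : set A.
Hypothesis N_sub : subspace N.

(** The evaluations at 1, -1, 2, -2 suffice: explicit combinations isolate [12 *: a1], [24 *: a2]
    and [12 *: a3], and 12 and 24 have no prime factors but 2 and 3. *)
Lemma quartic_coef_eq0 (a1 a2 a3 a4 : A) : (3 : K) != 0 ->
    (forall t : K, t *: a1 + t ^+ 2 *: a2 + t ^+ 3 *: a3 + t ^+ 4 *: a4 = 0) ->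
  [/\ a1 = 0, a2 = 0 & a3 = 0].
Proof.
move=> K3 H.
pose P (x1 x2 x3 x4 : K) := x1 *: a1 + x2 *: a2 + x3 *: a3 + x4 *: a4.
(* Adding [c] times the relation at [t] changes the coefficients but not the value. *)
have PD c t x1 x2 x3 x4 : P x1 x2 x3 x4 =
    P (x1 + c * t) (x2 + c * t ^+ 2) (x3 + c * t ^+ 3) (x4 + c * t ^+ 4).
  rewrite -[LHS]addr0 -[X in _ + X](scaler0 _ c) -(H t) /P !scalerDr !scalerA !scalerDl.
  by rewrite (AC (4*4) (((1*5)*(2*6))*(3*7)*(4*8))).
have P0 : P 0 0 0 0 = 0 by rewrite /P !scale0r !addr0.
have K12 : (12 : K) != 0.
  by rewrite (_ : 12 = 2 * 2 * 3) ?mulf_neq0 //; ring.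
have K24 : (24 : K) != 0.
  by rewrite (_ : 24 = 2 * 12) ?mulf_neq0 //; ring.
have P_eq0 c1 c2 c3 c4 x1 x2 x3 x4 :
    x1 = c1 - c2 + c3 * 2 - c4 * 2 -> x2 = c1 + c2 + c3 * 4 + c4 * 4 ->
    x3 = c1 - c2 + c3 * 8 - c4 * 8 -> x4 = c1 + c2 + c3 * 16 + c4 * 16 ->
    P x1 x2 x3 x4 = 0.
  move=> -> -> -> ->; rewrite -P0.
  rewrite [RHS](PD c1 1) [RHS](PD c2 (-1)) [RHS](PD c3 2) [RHS](PD c4 (-2)).
  by congr P; ring.
split.
- have := P_eq0 8 (- 8) (- 1) 1 12 0 0 0.
  rewrite /P !scale0r !addr0 => /(_ _ _ _ _)/eqP.
  by rewrite scaler_eq0 (negPf K12) => /(_ _ _ _ _)/eqP; apply; ring.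
- have := P_eq0 16 16 (- 1) (- 1) 0 24 0 0.
  rewrite /P !scale0r !addr0 add0r => /(_ _ _ _ _)/eqP.
  by rewrite scaler_eq0 (negPf K24) => /(_ _ _ _ _)/eqP; apply; ring.
- have := P_eq0 (- 2) 2 1 (- 1) 0 0 12 0.
  rewrite /P !scale0r !addr0 !add0r => /(_ _ _ _ _)/eqP.
  by rewrite scaler_eq0 (negPf K12) => /(_ _ _ _ _)/eqP; apply; ring.
Qed.

Lemma bilinear_polar (B : A -> A -> A) :
    (forall x y z, B (x + y) z = B x z + B y z) ->
    (forall x y z, B x (y + z) = B x y + B x z) ->
    (forall x y, B x y = B y x) ->
    (forall x, N x -> B x x = 0) ->
  forall x y, N x -> N y -> B x y = 0.
Proof.
move=> BDl BDr BC B0 x y Nx Ny; apply: (addvv_eq0 K2).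
have := B0 _ (subspaceD N_sub Nx Ny).
by rewrite BDl !BDr !B0 // add0r addr0 [B y x]BC.
Qed.

(** [D x y] is the part of the cubic form at [x + y] that is linear in [y]. Replacing [y] by [- y]
    separates it from [D y x]; polarising it in [x] then gives each cyclic term twice, by symmetry
    in the last two arguments. *)
Lemma trilinear_polar (T : A -> A -> A -> A) :
    (forall x y z t, T (x + y) z t = T x z t + T y z t) ->
    (forall x y z t, T x (y + z) t = T x y t + T x z t) ->
    (forall x y z, T x y z = T x z y) ->
    (forall x, N x -> T x x x = 0) ->
  forall x y z, N x -> N y -> N z -> T x y z + T y z x + T z x y = 0.
Proof.
move=> TD1 TD2 TC T0.
have TD3 x y z t : T x y (z + t) = T x y z + T x y t by rewrite TC TD2 ![T x _ y]TC.
have T01 y z : T 0 y z = 0 by apply: (addrI (T 0 y z)); rewrite -TD1 !addr0.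
have T02 x z : T x 0 z = 0 by apply: (addrI (T x 0 z)); rewrite -TD2 !addr0.
have TN1 x y z : T (- x) y z = - T x y z.
  by apply/eqP; rewrite -subr_eq0 opprK -TD1 addNr T01.
have TN2 x y z : T x (- y) z = - T x y z.
  by apply/eqP; rewrite -subr_eq0 opprK -TD2 addNr T02.
have TN3 x y z : T x y (- z) = - T x y z by rewrite TC TN2 TC.
pose D x y := T y x x + T x y x + T x x y.
have TD x y : T (x + y) (x + y) (x + y) = T x x x + D x y + D y x + T y y y.
  rewrite !TD1 !TD2 !TD3 /D.
  by rewrite (AC ((2*2)*(2*2)) ((1*((5*3)*2))*((4*6)*7)*8)).
have D_anti x y : N x -> N y -> D x y + D y x = 0.
  move=> Nx Ny; have := T0 _ (subspaceD N_sub Nx Ny).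
  by rewrite TD !T0 // add0r addr0.
have D0 x y : N x -> N y -> D x y = 0.
  move=> Nx Ny; apply: (addvv_eq0 K2).
  have := D_anti _ _ Nx (subspaceN N_sub Ny).
  rewrite /D !TN1 !TN2 !TN3 !opprK -!opprD -/(D x y) -/(D y x).
  move=> /eqP; rewrite addrC subr_eq0 => /eqP eD.
  by rewrite -[X in _ + X]eD D_anti.
move=> x y z Nx Ny Nz; apply: (addvv_eq0 K2).
have := D0 _ _ (subspaceD N_sub Nx Nz) Ny.
rewrite /D !TD1 !TD2 !TD3.
rewrite (AC (((2*2)*(2*2))*(2*2)) (((1*5*9)*(4*8*12))*((6*3*11)*(10*2*7)))).
rewrite /= -/(D x y) -/(D z y) !D0 // addr0 add0r.
by rewrite [T x z y]TC [T y x z]TC [T z y x]TC.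
Qed.

End Polarization.

(** * Products precomposed with linear maps *)

Section BilinearComp.
Variables (K : fieldType) (A : lmodType K) (mul : {bilinear A -> A -> A}).

Definition comp_bilinear (f g : {linear A -> A}) (x y : A) : A := mul (f x) (g y).

Lemma comp_bilinear_subproof (f g : {linear A -> A}) :
  bilinear_for *:%R *:%R (comp_bilinear f g).
Proof.
by split=> z a x y; rewrite /comp_bilinear linearP ?linearPl ?linearPr.
Qed.

HB.instance Definition _ f g :=
  bilinear_isBilinear.Build K A A A *:%R *:%R (comp_bilinear f g)
    (comp_bilinear_subproof f g).

End BilinearComp.

(** * Peirce multiplication rules of a Bernstein algebra *)

Section Peirce.
Variables (K : fieldType) (A : lmodType K).
Variables (mul : {bilinear A -> A -> A}) (omega : {scalar A}).
Hypotheses (K2 : (2 : K) != 0) (K3 : (3 : K) != 0).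
Hypothesis A_bernstein : bernstein mul omega.
Variable e : A.
Hypotheses (e_neq0 : e != 0) (e_idem : mul e e = e).

Local Notation U := (peirceU mul e).
Local Notation V := (peirceV mul e).
Local Notation N := [set x | omega x = 0].

Lemma mulC x y : mul x y = mul y x.
Proof. by case: A_bernstein. Qed.

Lemma omega_e : omega e = 1.
Proof.
case: A_bernstein => _ omegaM _ /(_ e); rewrite !e_idem => ee.
have := omegaM e e; rewrite e_idem -[LHS]mulr1 => /esym/eqP.
have [w0|w0] := eqVneq (omega e) 0; last by move/eqP/(mulfI w0).
by move: e_neq0; rewrite ee w0 expr0n scale0r eqxx.
Qed.

Lemma ker_omega_sub : subspace N.
Proof.
split=> [|a x y /= x0 y0]; first exact: linear0.
by rewrite linearP x0 y0 mulr0 addr0.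
Qed.

Lemma mul_sqr x y (t : K) : mul (x + t *: y) (x + t *: y) =
  mul x x + (2 * t) *: mul x y + t ^+ 2 *: mul y y.
Proof.
rewrite linearDl !linearDr !linearZl_LR !linearZr_LR scalerA -expr2 addrA.
by rewrite [mul y x]mulC -[X in X + _]addrA -scalerDl -mulr2n mulr_natl.
Qed.

(** These are the coefficients of t, t^2 and t^3 in the Bernstein identity at e + t y, an element of
    weight 1. *)
Lemma bernstein_coef y : N y -> let ey := mul e y in let yy := mul y y in
  [/\ 2 *: mul e ey = ey, 4 *: mul ey ey + 2 *: mul e yy = yy & mul ey yy = 0].
Proof.
move=> Ny ey yy; have y0 : omega y = 0 := Ny.
have K4 : (4 : K) != 0 by rewrite (_ : 4 = 2 * 2) ?mulf_neq0 //; ring.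
have [|/subr0_eq c1 /subr0_eq c2 /eqP c3] :=
  @quartic_coef_eq0 K A K2 (4 *: mul e ey - 2 *: ey)
  (4 *: mul ey ey + 2 *: mul e yy - yy) (4 *: mul ey yy) (mul yy yy) K3.
- move=> t; case: A_bernstein => _ _ _ /(_ (e + t *: y)).
  have -> : omega (e + t *: y) = 1 by rewrite linearD linearZ y0 omega_e /= mulr0 addr0.
  rewrite expr1n scale1r.
  rewrite [mul (e + _) _]mul_sqr e_idem -/ey -/yy mul_sqr mul_sqr e_idem.
  rewrite linearDl linearZl_LR.
  rewrite -!addrA => /addrI /eqP; rewrite -subr_eq0 => /eqP <-.
  rewrite !opprD -!scaleNr !scalerDr !scalerN -!scaleNr !scalerA.
  rewrite [RHS](AC ((1*(1*3))*2) ((1*6)*((2*(3*7))*(4*5)))) /=.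
  by do 6?congr (_ + _); congr (_ *: _); ring.
split; last by move: c3; rewrite scaler_eq0 (negPf K4) => /eqP.
- by apply: (scalerI K2); rewrite scalerA -c1; congr (_ *: _); ring.
- exact: c2.
Qed.

Lemma mul_e_mul_e y : N y -> 2 *: mul e (mul e y) = mul e y.
Proof. by case/bernstein_coef. Qed.

Lemma mul_e_mul y z : N y -> N z ->
  4 *: mul (mul e y) (mul e z) + 2 *: mul e (mul y z) = mul y z.
Proof.
move=> Ny Nz; apply/eqP; rewrite -subr_eq0; apply/eqP.
apply: (bilinear_polar K2 ker_omega_sub (B := fun y z =>
  4 *: mul (mul e y) (mul e z) + 2 *: mul e (mul y z) - mul y z)) => // {y z Ny Nz}.
- move=> x y z; rewrite !(linearDl, linearDr) !scalerDr opprD.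
  by rewrite (AC ((2*2)*2) (((1*3)*5)*((2*4)*6))).
- move=> x y z; rewrite !(linearDl, linearDr) !scalerDr opprD.
  by rewrite (AC ((2*2)*2) (((1*3)*5)*((2*4)*6))).
- by move=> x y; rewrite [mul x y]mulC [mul (mul _ x) _]mulC.
- by move=> x /bernstein_coef [_ -> _]; rewrite subrr.
Qed.

(** Since [e] acts as 1/2 on [U] and as 0 on [V], specialising this to Peirce components yields
    [mul_UUU], [mul_UUV] and [mul_UVV]. *)
Lemma mul_e_mul3 x y z : N x -> N y -> N z ->
  mul (mul e x) (mul y z) + mul (mul e y) (mul z x) + mul (mul e z) (mul x y) = 0.
Proof.
apply: (trilinear_polar K2 ker_omega_sub (T := fun x y z => mul (mul e x) (mul y z))).
- by move=> *; rewrite linearDr linearDl.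
- by move=> *; rewrite linearDl linearDr.
- by move=> a b c; rewrite [mul b c]mulC.
- by move=> a /bernstein_coef[].
Qed.

Lemma peirceU_ker x : U x -> N x.
Proof.
move=> Ux; have := congr1 omega Ux; case: A_bernstein => _ omegaM _ _.
rewrite linearZ omegaM omega_e /= mul1r => /eqP.
by rewrite -subr_eq0 -{2}[omega x]mul1r -mulrBl (_ : 2 - 1 = 1) ?mul1r; [move/eqP | ring].
Qed.

Lemma peirceV_ker x : V x -> N x.
Proof.
move=> Vx; have := congr1 omega Vx; case: A_bernstein => _ omegaM _ _.
by rewrite linear0 omegaM omega_e mul1r.
Qed.

Lemma peirceU_mul_e x : U x -> mul e x = 2^-1 *: x.
Proof. by move=> Ux; apply: (scalerI K2); rewrite Ux scalerA mulfV // scale1r. Qed.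

Lemma peirceUU x y : U x -> U y -> V (mul x y).
Proof.
move=> Ux Uy; have := mul_e_mul (peirceU_ker Ux) (peirceU_ker Uy).
rewrite (peirceU_mul_e Ux) (peirceU_mul_e Uy) linearZl_LR linearZr_LR !scalerA.
rewrite (_ : 4 * (2^-1 / 2) = 1 :> K); last by field.
rewrite scale1r -[RHS]addr0 => /addrI /eqP.
by rewrite scaler_eq0 (negPf K2) => /eqP.
Qed.

Lemma peirceVU x y : V x -> U y -> U (mul x y).
Proof.
move=> Vx Uy; have := mul_e_mul (peirceV_ker Vx) (peirceU_ker Uy).
by rewrite [mul e x]Vx linear0l scaler0 add0r.
Qed.

Lemma peirceVV x y : V x -> V y -> U (mul x y).
Proof.
move=> Vx Vy; have := mul_e_mul (peirceV_ker Vx) (peirceV_ker Vy).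
by rewrite [mul e x]Vx linear0l scaler0 add0r.
Qed.

Lemma peirceV_sub : subspace V.
Proof.
split=> [|a x y Vx Vy]; first by rewrite /peirceV /= linear0r.
by rewrite /peirceV /= linearPr Vx Vy scaler0 addr0.
Qed.

Lemma mul_UUU x y z : U x -> U y -> U z ->
  mul (mul x y) z + mul (mul y z) x + mul (mul z x) y = 0.
Proof.
move=> Ux Uy Uz.
have := mul_e_mul3 (peirceU_ker Ux) (peirceU_ker Uy) (peirceU_ker Uz).
rewrite (peirceU_mul_e Ux) (peirceU_mul_e Uy) (peirceU_mul_e Uz).
rewrite !linearZl_LR -!scalerDr => /eqP.
rewrite scaler_eq0 invr_eq0 (negPf K2) /= => /eqP.
by rewrite [mul x _]mulC [mul y (mul _ _)]mulC [mul z (mul _ _)]mulC addrC addrA.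
Qed.

Lemma mul_UUV x y v : U x -> U y -> V v -> mul x (mul v y) = - mul y (mul v x).
Proof.
move=> Ux Uy Vv.
have := mul_e_mul3 (peirceU_ker Ux) (peirceU_ker Uy) (peirceV_ker Vv).
rewrite [mul e v]Vv linear0l addr0 (peirceU_mul_e Ux) (peirceU_mul_e Uy).
rewrite !linearZl_LR -!scalerDr => /eqP.
by rewrite scaler_eq0 invr_eq0 (negPf K2) /= addr_eq0 [mul y v]mulC => /eqP.
Qed.

Lemma mul_UVV x v w : U x -> V v -> V w -> mul x (mul v w) = 0.
Proof.
move=> Ux Vv Vw.
have := mul_e_mul3 (peirceU_ker Ux) (peirceV_ker Vv) (peirceV_ker Vw).
rewrite [mul e v]Vv [mul e w]Vw !linear0l !addr0 (peirceU_mul_e Ux) linearZl_LR => /eqP.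
by rewrite scaler_eq0 invr_eq0 (negPf K2) /= => /eqP.
Qed.

(* Projections defined on all of [A], so that the identities below hold
   without membership hypotheses and [U = V = A] can be taken in the
   previous results on anticommuting actions. *)
Definition projN x := x - omega x *: e.
Definition projU x := 2 *: mul e (projN x).
Definition projV x := projN x - projU x.

Lemma projN_is_linear : linear projN.
Proof.
move=> a x y; rewrite /projN linearP scalerDl scalerBr scalerA opprD.
by rewrite (AC ((2*2)) ((1*3)*(2*4))).
Qed.

HB.instance Definition _ := GRing.isLinear.Build K A A *:%R projN projN_is_linear.

Lemma projU_is_linear : linear projU.
Proof.
move=> a x y; rewrite /projU linearP linearPr scalerDr scalerA mulrC.
by rewrite -scalerA.
Qed.

HB.instance Definition _ := GRing.isLinear.Build K A A *:%R projU projU_is_linear.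

Lemma projV_is_linear : linear projV.
Proof.
move=> a x y; rewrite /projV [projN _]linearP [projU _]linearP scalerBr opprD.
by rewrite (AC ((2*2)) ((1*3)*(2*4))).
Qed.

HB.instance Definition _ := GRing.isLinear.Build K A A *:%R projV projV_is_linear.

Lemma projN_ker x : N (projN x).
Proof. by rewrite /projN /= linearB linearZ omega_e /= mulr1 subrr. Qed.

(** By [mul_e_mul_e], twice the multiplication by [e] is idempotent on the kernel of [omega]. *)
Lemma projU_peirce x : U (projU x).
Proof.
by rewrite /peirceU /= /projU linearZr_LR (mul_e_mul_e (projN_ker x)).
Qed.

Lemma projV_peirce x : V (projV x).
Proof.
by rewrite /peirceV /= /projV linearBr linearZr_LR (mul_e_mul_e (projN_ker x)) subrr.
Qed.

Lemma peirce_decomp x : x = omega x *: e + (projU x + projV x).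
Proof. by rewrite /projV [projU x + _]addrC subrK addrC subrK. Qed.

Lemma projU_id x : U x -> projU x = x.
Proof. by move=> Ux; rewrite /projU /projN (peirceU_ker Ux) scale0r subr0. Qed.

Lemma projV_id x : V x -> projV x = x.
Proof.
move=> Vx; rewrite /projV /projU /projN (peirceV_ker Vx) scale0r subr0.
by rewrite Vx scaler0 subr0.
Qed.

Hypothesis L2_eq0 : forall v u, V v -> U u -> mul v (mul v u) = 0.

Lemma mul_VVU v w x : V v -> V w -> U x -> mul v (mul w x) = - mul w (mul v x).
Proof.
move=> Vv Vw Ux; apply/eqP; rewrite -addr_eq0.
have := L2_eq0 (subspaceD peirceV_sub Vv Vw) Ux.
by rewrite !linearDl !linearDr !L2_eq0 // add0r addr0 => ->.
Qed.

Let act := comp_bilinear mul projV projU : {bilinear A -> A -> A}.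
Let prd := comp_bilinear mul projU projU : {bilinear A -> A -> A}.
Let vv := comp_bilinear mul projV projV : {bilinear A -> A -> A}.

Let actE v x : act v x = mul (projV v) (projU x). Proof. by []. Qed.
Let prdE x y : prd x y = mul (projU x) (projU y). Proof. by []. Qed.

Let act_peirce v x : U (act v x).
Proof. exact: peirceVU (projV_peirce v) (projU_peirce x). Qed.

Let prd_peirce x y : V (prd x y).
Proof. exact: peirceUU (projU_peirce x) (projU_peirce y). Qed.

Let vv_peirce v w : U (vv v w).
Proof. exact: peirceVV (projV_peirce v) (projV_peirce w). Qed.

Let actA v w x : act v (act w x) = - act w (act v x).
Proof.
rewrite (actE v (act w x)) (actE w (act v x)) !(projU_id (act_peirce _ _)).
exact: mul_VVU (projV_peirce v) (projV_peirce w) (projU_peirce x).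
Qed.

Let prdC x y : prd x y = prd y x.
Proof. exact: mulC. Qed.

Let prd_skew x y v : prd x (act v y) = - prd y (act v x).
Proof.
rewrite !prdE !(projU_id (act_peirce _ _)).
exact: mul_UUV (projU_peirce x) (projU_peirce y) (projV_peirce v).
Qed.

Let prd_cyc x y z : act (prd x y) z + act (prd y z) x + act (prd z x) y = 0.
Proof.
rewrite !actE !(projV_id (prd_peirce _ _)).
exact: mul_UUU (projU_peirce x) (projU_peirce y) (projU_peirce z).
Qed.

Let prd_vv x v w : prd x (vv v w) = 0.
Proof.
rewrite prdE (projU_id (vv_peirce v w)).
exact: mul_UVV (projU_peirce x) (projV_peirce v) (projV_peirce w).
Qed.

(** * Nonassociative monomials and the degree filtration *)

Section Monomials.
Variable gens : seq A.

Inductive mon : nat -> A -> Prop :=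
| MonGen g : g \in gens -> mon 1 g
| MonMul d1 d2 x y : mon d1 x -> mon d2 y -> mon (d1 + d2) (mul x y).

Lemma mon_gt0 d x : mon d x -> (0 < d)%N.
Proof. by elim=> // d1 d2 y z _ h1 _ _; rewrite addn_gt0 h1. Qed.

Fixpoint mon_seq n : seq A :=
  if n is n'.+1 then gens ++ [seq mul x y | x <- mon_seq n', y <- mon_seq n']
  else [::].

(** Degrees are positive, so both factors of a product have strictly smaller degree and are found
    one recursion level below. *)
Lemma mem_mon_seq n d x : mon d x -> (d <= n)%N -> x \in mon_seq n.
Proof.
elim: n d x => [|n IHn] d x dx; first by have := mon_gt0 dx; lia.
case: dx => [g gg _|d1 d2 y z dy dz led] /=; first by rewrite mem_cat gg.
have := mon_gt0 dy; have := mon_gt0 dz => gt2 gt1.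
rewrite mem_cat; apply/orP; right; apply: allpairs_f.
  by apply: IHn dy _; lia.
by apply: IHn dz _; lia.
Qed.

Definition mon_span n := Defs.span [set x | exists2 d, (n <= d)%N & mon d x].

Lemma mon_span_sub n : subspace (mon_span n).
Proof. exact: subspace_span. Qed.

Lemma mon_spanM m n x y :
  mon_span m x -> mon_span n y -> mon_span (m + n) (mul x y).
Proof.
move=> mx; move: y.
pose P := [set x | forall y, mon_span n y -> mon_span (m + n) (mul x y)].
suff: mon_span m `<=` P by apply.
have [m0 mD] := mon_span_sub (m + n).
apply: span_min => [|{mx}x [d1 led1 dx] y].
  split=> [y _|a z t Pz Pt y ny]; first by rewrite linear0l.
  by rewrite linearPl; apply: mD; [apply: Pz | apply: Pt].
apply: (span_min (subspace_preimage (mul x) (mon_span_sub _))) => {}y [d2 led2 dy].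
by apply: sub_span; exists (d1 + d2)%N; [rewrite leq_add | apply: MonMul].
Qed.

End Monomials.

(** * Reduction to Peirce components of the generators, and conclusion *)

Section HomogeneousGenerators.
Variable S : seq A.

Let us := [seq projU s | s <- S].
Let vs := [seq projV s | s <- S].

Let us_peirce x : x \in us -> U x.
Proof. by case/mapP => s _ ->; apply: projU_peirce. Qed.

Let vs_peirce x : x \in vs -> V x.
Proof. by case/mapP => s _ ->; apply: projV_peirce. Qed.

Local Notation vmon := (vmon act prd us vs).
Local Notation umon := (umon act prd us vs vv).

Lemma vmon_peirce d v : vmon d v -> V v.
Proof. by case=> [w /vs_peirce //|p q n s _ _ _]; apply: prd_peirce. Qed.

(** The scalar absorbs the signs of [prd_umon], and 0 its vanishing products. Membership in [U] or
    [V] is recorded so that the projections inside [act], [prd] and [vv] can be removed. *)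
Definition homogeneous d x := x = 0 \/ exists (a : K) y,
  x = a *: y /\ (U y /\ umon d y \/ V y /\ vmon d y).

Lemma mon_homogeneous d x : mon (us ++ vs) d x -> homogeneous d x.
Proof.
elim=> {d x} [g|d1 d2 x1 x2 _ h1 _ h2].
  rewrite mem_cat => /orP[gus|gvs]; right; exists 1, g; rewrite scale1r; split=> //.
    by left; split; [exact: us_peirce | exact: (UmonGen _ (VwordNil _ _ _ _) gus)].
  by right; split; [exact: vs_peirce | exact: VmonGen].
have [->|[a1 [y1 [-> h1']]]] := h1; first by left; rewrite linear0l.
have [->|[a2 [y2 [-> h2']]]] := h2; first by left; rewrite linear0r.
rewrite linearZl_LR linearZr_LR scalerA.
have act_case v x m n : V v -> U x -> vmon m v -> umon n x ->
    homogeneous (m + n) ((a1 * a2) *: mul v x).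
  move=> Vv Ux mv nx; right; exists (a1 * a2), (mul v x); split=> //; left.
  split; first exact: peirceVU.
  have -> : mul v x = act v x by rewrite actE projV_id ?projU_id.
  exact: umon_act.
case: h1' h2' => -[P1 m1] [] [P2 m2].
- have e12 : mul y1 y2 = prd y1 y2 by rewrite prdE !projU_id.
  have [p0|[c [v [mv ev]]]] := prd_umon prdC prd_skew prd_vv m1 m2.
    by left; rewrite e12 p0 scaler0.
  right; exists (a1 * a2 * c), v; rewrite e12 ev scalerA; split=> //.
  by right; split=> //; apply: vmon_peirce mv.
- by rewrite addnC mulC; apply: act_case.
- exact: act_case.
- right; exists (a1 * a2), (mul y1 y2); split=> //; left; split; first exact: peirceVV.
  have -> : mul y1 y2 = acts act [::] (vv y1 y2).
    by rewrite -[RHS]/(mul (projV y1) (projV y2)) !projV_id.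
  exact: (UmonVV _ (VwordNil _ _ _ _) m1 m2).
Qed.

Lemma mon_eq0 : exists D, forall d x, mon (us ++ vs) d x -> (D <= d)%N -> x = 0.
Proof.
exists (umon_bound us vs + (degree_bound us vs).+2)%N => d x.
case/mon_homogeneous => [-> //|[a [y [-> [] [_ dy]]]]] led.
  by rewrite (umon_eq0 K2 actA prdC prd_skew prd_cyc dy) ?scaler0 //; lia.
by rewrite (vmon_eq0 K2 actA prdC prd_skew prd_cyc dy) ?scaler0 //; lia.
Qed.

Lemma mon_mul_e n x : mon_span (us ++ vs) n x -> mon_span (us ++ vs) n (mul e x).
Proof.
have [s0 _] := mon_span_sub (us ++ vs) n.
apply: (span_min (subspace_preimage (mul e) (mon_span_sub _ _))) => {}x [d led dx].
rewrite /preimage /=; have [->|[a [y [ex yP]]]] := mon_homogeneous dx.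
  by rewrite linear0r.
have mx : mon_span (us ++ vs) n x by apply: sub_span; exists d.
case: yP => -[Py _]; last by rewrite ex linearZr_LR [mul e y]Py scaler0.
rewrite ex linearZr_LR (peirceU_mul_e Py) scalerA mulrC -scalerA -ex.
exact: subspaceZ (mon_span_sub _ _) mx.
Qed.

Hypothesis S_gen : smallest (subalgebra mul) [set` S] = [set: A].

(** The elements of this form make a subalgebra, since by [mon_mul_e] multiplication by [e]
    preserves the span of monomials, and it contains [S] by the Peirce decomposition. *)
Lemma mon_span_decomp x :
  exists (a : K) y, mon_span (us ++ vs) 1 y /\ x = a *: e + y.
Proof.
pose P := [set x | exists (a : K) y, mon_span (us ++ vs) 1 y /\ x = a *: e + y].
have mon1_sub := mon_span_sub (us ++ vs) 1; have [s0 sD] := mon1_sub.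
suff: smallest (subalgebra mul) [set` S] `<=` P by rewrite S_gen; apply.
apply: smallest_sub => [|s /= sS].
  split; first split; first by exists 0, 0; rewrite scale0r addr0.
    move=> a _ _ [b [y [my ->]]] [c [z [mz ->]]].
    exists (a * b + c), (a *: y + z); split; first exact: sD.
    by rewrite scalerDr scalerDl scalerA addrACA.
  move=> _ _ [b [y [my ->]]] [c [z [mz ->]]].
  exists (b * c), (b *: mul e z + (c *: mul e y + mul y z)); split.
    apply: (sD); first exact: mon_mul_e.
    apply: (sD); first exact: mon_mul_e.
    have := mon_spanM my mz; apply: span_min => // t [d led dt].
    by apply: sub_span; exists d => //; lia.
  rewrite linearDl !linearDr !linearZl_LR !linearZr_LR e_idem scalerA.
  by rewrite [mul y e]mulC !addrA.
exists (omega s), (projU s + projV s); split; last exact: peirce_decomp.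
apply: subspaceD mon1_sub _ _; apply: sub_span; exists 1%N => //; apply: MonGen;
  by rewrite mem_cat map_f ?orbT.
Qed.

Lemma mon_peirceN d x : mon (us ++ vs) d x -> N x.
Proof.
case/mon_homogeneous => [->|[a [y [-> yP]]]]; first exact: (ker_omega_sub).1.
apply: (subspaceZ _ ker_omega_sub).
by case: yP => -[Py _]; [apply: peirceU_ker | apply: peirceV_ker].
Qed.

Lemma npow_mon_span n :
  (0 < n)%N -> npow mul (peirceN mul e) n `<=` mon_span (us ++ vs) n.
Proof.
elim/ltn_ind: n => -[|[|n]] // IHn _ x.
  rewrite npow1 => -[u Uu [v Vv <-]].
  (* Applying [omega] shows that the coefficient of [e] in the decomposition of [u + v] is zero. *)
  have : N (u + v).
    by apply: (subspaceD ker_omega_sub); [apply: peirceU_ker|apply: peirceV_ker].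
  have [a [y [my ->]]] := mon_span_decomp (u + v).
  have y0 : omega y = 0.
    by apply: (span_min ker_omega_sub) my => t [d _ dt]; apply: mon_peirceN dt.
  by rewrite /= linearD linearZ y0 omega_e /= mulr1 addr0 => ->; rewrite scale0r add0r.
rewrite npowE //; move: x; apply: (span_min (mon_span_sub _ _)).
move=> _ [i [j [i0 j0 eij [x [y [ix jy ->]]]]]]; rewrite -eij.
by apply: mon_spanM; [apply: IHn ix => //; lia | apply: IHn jy => //; lia].
Qed.

Lemma finite_dimensional_nilpotent :
  finite_dimensional A /\ nilpotent_set mul (peirceN mul e).
Proof.
have [D monD] := mon_eq0; split; last first.
  (* The exponent exceeds 1, so that [npowE] presents this power as a span, which contains 0. *)
  exists D.+2; split=> //; apply/seteqP; split=> x.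
    suff sub0 : mon_span (us ++ vs) D.+2 `<=` [set 0] by move/npow_mon_span/sub0; apply.
    apply: (span_min (@subspace_set0 K A)) => t [d led dt].
    by apply: monD dt _; lia.
  by move=> ->; rewrite npowE //; exact: (subspace_span _).1.
(* Monomials of degree at least [D] vanish, and those of smaller degree are in this finite list. *)
apply: (@finite_dimensional_span _ _ (e :: mon_seq (us ++ vs) D)).
apply/seteqP; split=> // x _; have [a [y [my ->]]] := mon_span_decomp x.
have spn_sub := subspace_span [set` e :: mon_seq (us ++ vs) D].
apply: spn_sub.2; first by apply: sub_span; rewrite /= mem_head.
move: my; apply: (span_min spn_sub) => t [d led dt].
have [leD|ltD] := leqP D d; first by rewrite (monD _ _ dt leD); exact: spn_sub.1.
by apply: sub_span; rewrite /= inE (mem_mon_seq dt (ltnW ltD)) orbT.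
Qed.

End HomogeneousGenerators.
End Peirce.

Theorem proposition7p4 (K : fieldType) (K_infinite : infinite_set [set: K])
    (K_char2 : 2%N \notin [pchar K]) (K_char3 : 3%N \notin [pchar K])
    (A : lmodType K) (mul : {bilinear A -> A -> A}) (omega : {scalar A})
    (A_bernstein : bernstein mul omega)
    (e : A) (e_neq0 : e != 0) (e_idem : mul e e = e)
    (A_fg : finitely_generated mul)
    (L2_eq0 : forall v u, peirceV mul e v -> peirceU mul e u ->
       mul v (mul v u) = 0) :
  finite_dimensional A /\ nilpotent_set mul (peirceN mul e).
Proof.
have [_ [/finite_seqP [S ->] S_gen]] := A_fg.
have K2 : (2 : K) != 0 by move: K_char2; rewrite inE.
have K3 : (3 : K) != 0 by move: K_char3; rewrite inE.
exact: (finite_dimensional_nilpotent K2 K3 A_bernstein e_neq0 e_idem L2_eq0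
          S_gen).
Qed.
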